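(* Let $p\in[1,\infty]$. Let $\boldsymbol{\mu}_+\ne\boldsymbol{\mu}_-\in\mathbb{R}^d$, $\sigma>0$, and let $(\boldsymbol{X},Y)$ be random with $P(Y=+)=P(Y=-)=1/2$ and $\boldsymbol{X}\mid Y=i\sim N(\boldsymbol{\mu}_i,\sigma^2\boldsymbol{I}_d)$. Let $\boldsymbol{w}\in\mathbb{R}^d\setminus\{\boldsymbol{0}\}$, $b\in\mathbb{R}$, and let the linear classifier assign $\boldsymbol{x}$ to class $+$ iff $\boldsymbol{w}\cdot\boldsymbol{x}+b>0$. Let $\varepsilon>0$, $\delta\ge0$, $\boldsymbol{\mu}=\frac12(\boldsymbol{\mu}_+-\boldsymbol{\mu}_-)$, $\bar{\boldsymbol{\mu}}=\frac12(\boldsymbol{\mu}_++\boldsymbol{\mu}_-)$, $b'=\boldsymbol{w}\cdot\bar{\boldsymbol{\mu}}+b$, $\boldsymbol{\mu}_0=\boldsymbol{\mu}/\|\boldsymbol{\mu}\|_2$. Let $\boldsymbol{u}_p$ be a maximizer of $|\boldsymbol{w}\cdot\boldsymbol{v}|$ over $\{\boldsymbol{v}\in\mathbb{R}^d:\|\boldsymbol{v}\|_p\le\varepsilon,\ |\boldsymbol{v}\cdot\boldsymbol{\mu}_0|\le\delta\}$ chosen with $\boldsymbol{w}\cdot\boldsymbol{u}_p\ge0$. Let $p_m$ be the probability that $\boldsymbol{X}$ is misclassified and $p_{s-adv|p}$ the probability that $\boldsymbol{X}$ is correctly classified and there is $\boldsymbol{x}'$ with $\|\boldsymbol{X}-\boldsymbol{x}'\|_p\le\varepsilon$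 and $|(\boldsymbol{X}-\boldsymbol{x}')\cdot\boldsymbol{\mu}_0|\le\delta$ that is assigned a different class than $\boldsymbol{X}$. Then $$p_{s-adv|p}=1-p_m-\frac12\left[\Phi\!\left(\frac{\boldsymbol{w}\cdot\boldsymbol{\mu}+b'}{\|\boldsymbol{w}\|_2\sigma}-\frac{\boldsymbol{w}\cdot\boldsymbol{u}_p}{\|\boldsymbol{w}\|_2\sigma}\right)+\Phi\!\left(\frac{\boldsymbol{w}\cdot\boldsymbol{\mu}-b'}{\|\boldsymbol{w}\|_2\sigma}-\frac{\boldsymbol{w}\cdot\boldsymbol{u}_p}{\|\boldsymbol{w}\|_2\sigma}\right)\right].$$
   Context: $\Phi$ denotes the standard normal CDF. Since the feasible set is symmetric under $\boldsymbol{v}\mapsto-\boldsymbol{v}$, a maximizer with $\boldsymbol{w}\cdot\boldsymbol{u}_p\ge0$ exists, and then $\boldsymbol{w}\cdot\boldsymbol{u}_p$ is the maximum of $\boldsymbol{w}\cdot\boldsymbol{v}$ over the feasible set. *)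

(* Defs.v *)
From HB Require Import structures.
From mathcomp Require Import all_boot all_order all_algebra.
From mathcomp Require Import all_classical all_reals all_analysis.
Set Implicit Arguments. Unset Strict Implicit. Unset Printing Implicit Defensive.
Import Order.TTheory GRing.Theory Num.Def Num.Theory.
Local Open Scope classical_set_scope.
Local Open Scope ring_scope.

Section defs.
Context {R : realType} {d : nat}.
Implicit Types x y : d.-tuple R.

(* vectors of R^d are represented as d-tuples (which carry the product sigma-algebra) *)
Definition vsub x y : d.-tuple R := [tuple tnth x i - tnth y i | i < d].
Definition vadd x y : d.-tuple R := [tuple tnth x i + tnth y i | i < d].
Definition vscale (a : R) x : d.-tuple R := [tuple a * tnth x i | i < d].
Definition dot x y : R := \sum_(i < d) tnth x i * tnth y i.
Definition norm2 x : R := Num.sqrt (dot x x).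

Definition pnorm (p : \bar R) x : R :=
  match p with
  | EFin r => (\sum_(i < d) `|tnth x i| `^ r) `^ r^-1
  | +oo%E => \big[Num.max/0]_(i < d) `|tnth x i|
  | -oo%E => 0
  end.
End defs.

Definition Phi {R : realType} (t : R) : R :=
  fine (normal_prob 0 1 `]-oo, t]).

(* Main.v *)
Require Import Defs.
From HB Require Import structures.
From mathcomp Require Import all_boot all_order all_algebra.
From mathcomp Require Import all_classical all_reals all_analysis.
From mathcomp Require Import measurable_realfun.
From mathcomp Require Import ring lra.
Import Order.TTheory GRing.Theory Num.Def Num.Theory.
Import numFieldNormedType.Exports.
Local Open Scope classical_set_scope.
Local Open Scope ring_scope.

(* Put c = w.u, the maximum of w.v over the admissible perturbations v (the
   admissible set is symmetric). Some admissible perturbation changes the class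
   of x iff -c < w.x + b <= c, so the complement of the adversarial event is the
   disjoint union of misclassification, {Y = +, w.X + b > c} and
   {Y = -, w.X + b <= -c}. Conditionally on Y = i, w.X is normal with mean w.mu_i
   and standard deviation sigma |w|: the coordinates are added one at a time, and
   the convolution of two normal laws is computed by Tonelli after completing the
   square. *)

(** * Affine changes of variable for Lebesgue measure *)

Section affine.
Context {R : realType}.
Local Notation mu := (@lebesgue_measure R).
Implicit Types a c m s x : R.

Lemma measurable_affine a c : measurable_fun [set: R] (fun x : R => a * x + c).
Proof. by apply: measurable_funD => //; exact: measurable_funM. Qed.

Lemma lebesgue_measure_affine_itvoc a c (x y : R) : a != 0 ->
  mu ((fun t : R => a * t + c) @^-1` `]x, y]) = (`|a|^-1%:E * mu `]x, y])%E.
Proof.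
move=> a0.
have [ap|an|/eqP] := ltgtP 0 a; last by rewrite eq_sym (negbTE a0).
- rewrite (_ : _ @^-1` _ = `](x - c) / a, (y - c) / a]%classic); last first.
    apply/seteqP; split => t /=; rewrite !in_itv/= ltr_pdivrMr// ler_pdivlMr//;
      by move=> /andP[? ?]; apply/andP; split; lra.
  rewrite !lebesgue_measure_itv/= !lte_fin ltr_pM2r ?invr_gt0// ltrD2r.
  case: ifPn => _; rewrite ?mule0//= -!EFinD -EFinM gtr0_norm//; congr _%:E.
  by field; rewrite gt_eqF.
(* A negative slope swaps the endpoints, so the closed end moves to the left; the length is
   unaffected. *)
- rewrite (_ : _ @^-1` _ = `[(y - c) / a, (x - c) / a[%classic); last first.
    apply/seteqP; split => t /=; rewrite !in_itv/= ltr_ndivlMr// ler_ndivrMr//;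
      by move=> /andP[? ?]; apply/andP; split; lra.
  rewrite !lebesgue_measure_itv/= !lte_fin ltr_nM2r ?invr_lt0// ltrD2r.
  case: ifPn => _; rewrite ?mule0//= -!EFinD -EFinM ltr0_norm//; congr _%:E.
  by field; rewrite lt_eqF.
Qed.

(** Lebesgue measure is determined by its values on half-open intervals, and [|a|] times its
    pushforward has those values. *)
Lemma lebesgue_measure_affine a c (A : set R) : a != 0 -> measurable A ->
  mu ((fun t : R => a * t + c) @^-1` A) = (`|a|^-1%:E * mu A)%E.
Proof.
move=> a0 mA.
pose phi := (fun x => a * x + c) : measurableTypeR R -> measurableTypeR R.
have mphi : measurable_fun [set: measurableTypeR R] phi by exact: measurable_affine.
pose nu := measure_function_pushforward__canonical__measure_function_Measure mu mphi.
pose m : {measure set (measurableTypeR R) -> \bar R} := mscale (NngNum (normr_ge0 a)) nu.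
have -> : mu A = m A.
  apply: lebesgue_measure_unique => // X [[x y]] _ <-.
  transitivity (`|a|%:E * mu ((fun t : R => (a * t + c)%R) @^-1` `]x, y]))%E; last by [].
  rewrite lebesgue_measure_affine_itvoc// muleA -EFinM divff ?mul1e//.
  by rewrite normr_eq0.
rewrite (_ : m A = (`|a|%:E * mu ((fun t : R => (a * t + c)%R) @^-1` A))%E) //.
by rewrite muleA -EFinM mulVf ?mul1e// normr_eq0.
Qed.

Lemma ge0_integral_affine a c (f : R -> \bar R) : a != 0 ->
  measurable_fun [set: R] f -> (forall x, 0 <= f x)%E ->
  (\int[mu]_x f x = `|a|%:E * \int[mu]_x f (a * x + c)%R)%E.
Proof.
move=> a0 mf f0.
pose phi := (fun x => a * x + c) : measurableTypeR R -> measurableTypeR R.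
have mphi : measurable_fun [set: measurableTypeR R] phi by exact: measurable_affine.
pose nu : {measure set (measurableTypeR R) -> \bar R} :=
  measure_function_pushforward__canonical__measure_function_Measure mu mphi.
transitivity (\int[mscale (NngNum (normr_ge0 a)) nu]_x f x)%E.
  apply: eq_measure_integral => A mA _.
  transitivity (`|a|%:E * mu ((fun t : R => (a * t + c)%R) @^-1` A))%E; last by [].
  rewrite lebesgue_measure_affine//.
  by rewrite muleA -EFinM divff ?mul1e// normr_eq0.
by rewrite ge0_integral_mscale//= ge0_integral_pushforward.
Qed.

End affine.

(** * Integration against normal laws and their affine images *)

Section normal.
Context {R : realType}.
Local Notation mu := (@lebesgue_measure R).
Implicit Types a c m s x : R.

(** The Radon-Nikodym derivative and [normal_pdf] have the same integral over every measurable set,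
    so they agree almost everywhere and may be exchanged under the integral. *)
Lemma integral_normal_prob m s (f : R -> \bar R) :
  measurable_fun [set: R] f -> (forall x, 0 <= f x)%E ->
  (\int[normal_prob m s]_x f x = \int[mu]_x (f x * (normal_pdf m s x)%:E))%E.
Proof.
move=> mf f0.
rewrite -(Radon_Nikodym_SigmaFinite.change_of_variables (normal_prob_dominates m s))//.
apply: ae_eq_integral => //.
- apply: emeasurable_funM => //; apply: (measurable_int mu).
  exact: (Radon_Nikodym_SigmaFinite.f_integrable (normal_prob_dominates m s)).
- apply: emeasurable_funM => //=; apply/measurable_EFinP; exact: measurable_normal_pdf.
- apply: ae_eqe_mul2l => /=.
  apply: integral_ae_eq => //.
  + exact: (Radon_Nikodym_SigmaFinite.f_integrable (normal_prob_dominates m s)).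
  + apply/measurable_EFinP; exact: measurable_normal_pdf.
  + by move=> A _ mA; rewrite -(Radon_Nikodym_SigmaFinite.f_integral (normal_prob_dominates m s)).
Qed.

Lemma normal_pdf_affine a c m s x : a != 0 -> s != 0 ->
  `|a| * normal_pdf (a * m + c) (a * s) (a * x + c) = normal_pdf m s x.
Proof.
move=> a0 s0; rewrite !normal_pdfE ?mulf_neq0// /normal_peak /normal_fun mulrA.
congr (_ * expR _); last by field; rewrite a0 s0.
rewrite exprMn -mulrA -mulrnAr sqrtrM ?sqr_ge0// sqrtr_sqr invfM mulrA divff ?mul1r//.
by rewrite normr_eq0.
Qed.

(** Extend both densities by zero outside their sets and substitute in the right-hand integral: the
    Jacobian [|a|] is absorbed by the normalising constant of the density. *)
Lemma normal_prob_affine a c m s (B : set R) : a != 0 -> s != 0 -> measurable B ->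
  normal_prob m s ((fun x => a * x + c) @^-1` B) = normal_prob (a * m + c) (a * s) B.
Proof.
move=> a0 s0 mB; rewrite /normal_prob integral_mkcond [RHS]integral_mkcond.
have mpdf m' s' (C : set R) : measurable C ->
    measurable_fun setT ((fun x => (normal_pdf m' s' x)%:E) \_ C).
  move=> mC; apply/(measurable_restrictT _ mC)/measurable_funTS/measurable_EFinP.
  exact: measurable_normal_pdf.
have pdf0 m' s' (C : set R) x : (0 <= ((fun x => (normal_pdf m' s' x)%:E) \_ C) x)%E.
  by rewrite /patch; case: ifPn => // _; rewrite lee_fin normal_pdf_ge0.
rewrite (ge0_integral_affine _ c _ a0 (mpdf (a * m + c) (a * s) B mB)); last exact: pdf0.
rewrite -ge0_integralZl//; last first.
  exact: (measurableT_comp (mpdf _ _ _ mB) (measurable_affine a c)).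
apply: eq_integral => x _; rewrite !patchE.
rewrite (_ : (x \in _) = (a * x + c \in B)); last by apply/idP/idP; rewrite !inE.
case: ifPn => _; last by rewrite mule0.
by rewrite -EFinM normal_pdf_affine.
Qed.

(** The density depends on [s] only through its square. This removes the sign that a negative slope
    puts on the deviation. *)
Lemma normal_prob_abs m s : normal_prob m `|s| = normal_prob m s.
Proof.
have [s0|s0|] := ltgtP s 0; last by move=> ->; rewrite normr0.
- rewrite ltr0_norm//; apply/funext => A; apply: eq_integral => x _.
  by rewrite !normal_pdfE ?oppr_eq0 ?lt_eqF// /normal_peak /normal_fun sqrrN.
- by rewrite gtr0_norm.
Qed.

End normal.

(** * Convolution of two normal laws *)

Section convolution.
Context {R : realType}.
Local Notation mu := (@lebesgue_measure R).
Implicit Types a c m s w x S : R.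

(* The last factor is the conditional density of x given z = t + w x, where
   t ~ N(m1, s1^2) and x ~ N(m2, s2^2) are independent. *)
Lemma normal_pdf_convolution m1 s1 m2 s2 w S x z :
  s1 != 0 -> s2 != 0 -> S != 0 -> S ^+ 2 = s1 ^+ 2 + w ^+ 2 * s2 ^+ 2 ->
  normal_pdf m2 s2 x * normal_pdf (w * x + m1) s1 z =
  normal_pdf (m1 + w * m2) S z *
  normal_pdf ((m2 * s1 ^+ 2 + w * s2 ^+ 2 * (z - m1)) / S ^+ 2) (s1 * s2 / S) x.
Proof.
move=> s10 s20 S0 SE.
rewrite !normal_pdfE ?mulf_neq0 ?invr_neq0// /normal_peak /normal_fun.
rewrite mulrACA [RHS]mulrACA -!expRD -!invfM.
have peak_ge0 t : 0 <= t ^+ 2 * pi *+ 2 :> R.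
  by rewrite mulrn_wge0// mulr_ge0 ?sqr_ge0 ?pi_ge0.
rewrite -!sqrtrM//.
congr ((sqrtr _)^-1 * expR _); first by field.
have S2 : s1 ^+ 2 + w ^+ 2 * s2 ^+ 2 != 0 by rewrite -SE expf_neq0.
rewrite expr_div_n exprMn SE; field.
by rewrite s10 s20 exprMn S2.
Qed.

Lemma ge0_integral_normal_pdf_indic m s (B : set R) : measurable B ->
  (\int[mu]_z ((\1_B z)%:E * (normal_pdf m s z)%:E) = normal_prob m s B)%E.
Proof.
move=> mB; rewrite /normal_prob [RHS]integral_mkcond; apply: eq_integral => z _.
by rewrite patchE indicE; case: ifPn => _; rewrite ?mul1e ?mul0e.
Qed.

(** Tonelli puts the integral over [x] inside. There the joint density splits into the marginal
    density of the sum and a conditional density of [x], which integrates to 1. *)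
Lemma normal_prob_convolution m1 s1 m2 s2 w S (B : set R) :
  s1 != 0 -> s2 != 0 -> S != 0 -> S ^+ 2 = s1 ^+ 2 + w ^+ 2 * s2 ^+ 2 ->
  measurable B ->
  (\int[normal_prob m2 s2]_x normal_prob m1 s1 ((fun t => t + w * x)%R @^-1` B)
   = normal_prob (m1 + w * m2) S B)%E.
Proof.
move=> s10 s20 S0 SE mB.
pose h := fun xz : measurableTypeR R * measurableTypeR R =>
  ((\1_B xz.2)%:E * (normal_pdf (w * xz.1 + m1) s1 xz.2)%:E)%E.
have h0 xz : (0 <= h xz)%E by rewrite mule_ge0// lee_fin normal_pdf_ge0.
have mh : measurable_fun setT h.
  apply: emeasurable_funM.
    apply/measurable_EFinP.
    by apply: measurableT_comp; [exact: measurable_indic|exact: measurable_snd].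
  apply/measurable_EFinP; under eq_fun do rewrite normal_pdfE//.
  apply: measurable_funM => //.
  apply: measurableT_comp => //.
  apply: measurable_funM => //.
  apply: measurableT_comp => //.
  apply: measurable_funX.
  apply: measurable_funB; first exact: measurable_snd.
  by apply: measurable_funD => //; apply: measurable_funM.
pose f := fun xz : measurableTypeR R * measurableTypeR R =>
  (h xz * (normal_pdf m2 s2 xz.1)%:E)%E.
have f0 xz : (0 <= f xz)%E by rewrite mule_ge0// lee_fin normal_pdf_ge0.
have mf : measurable_fun setT f.
  apply: emeasurable_funM => //.
  apply/measurable_EFinP.
  by apply: measurableT_comp; [exact: measurable_normal_pdf|exact: measurable_fst].
have shiftE x : normal_prob m1 s1 ((fun t => t + w * x) @^-1` B) =
    normal_prob (w * x + m1) s1 B.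
  rewrite (_ : _ @^-1` _ = (fun t => 1 * t + w * x) @^-1` B); last first.
    by apply/seteqP; split => t /=; rewrite mul1r.
  by rewrite normal_prob_affine ?oner_neq0// !mul1r addrC.
under eq_integral do rewrite shiftE.
(* Measurability in the parameter [x] comes from Tonelli, the probability being a partial integral
   of [h]. *)
have mg : measurable_fun setT (fun x => normal_prob (w * x + m1) s1 B).
  under eq_fun do rewrite -ge0_integral_normal_pdf_indic//.
  exact: (measurable_fun_fubini_tonelli_F (m2 := mu) h mh h0).
rewrite integral_normal_prob//.
transitivity (\int[mu]_x \int[mu]_z f (x, z))%E.
  apply: eq_integral => x _.
  rewrite -(ge0_integral_normal_pdf_indic (w * x + m1) s1 B mB).
  rewrite -ge0_integralZr//.
  - apply: emeasurable_funM; apply/measurable_EFinP; first exact: measurable_indic.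
    exact: measurable_normal_pdf.
  - by move=> z _; exact: (h0 (x, z)).
  - by rewrite lee_fin normal_pdf_ge0.
rewrite fubini_tonelli// -ge0_integral_normal_pdf_indic//.
apply: eq_integral => z _; rewrite /f /h /=.
(* After completing the square, [x] occurs only in the last factor, a normal density of total mass
   1. *)
transitivity (\int[mu]_x (((\1_B z)%:E * (normal_pdf (m1 + w * m2) S z)%:E) *
    (normal_pdf ((m2 * s1 ^+ 2 + w * s2 ^+ 2 * (z - m1)) / S ^+ 2) (s1 * s2 / S) x)%:E))%E.
  apply: eq_integral => x _; rewrite -!muleA -!EFinM; congr ((_ * _)%:E).
  by rewrite mulrC; exact: normal_pdf_convolution.
rewrite ge0_integralZl//.
- by rewrite integral_normal_pdf mule1.
- by apply/measurable_EFinP; exact: measurable_normal_pdf.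
- by move=> x _; rewrite lee_fin normal_pdf_ge0.
- by rewrite mule_ge0// lee_fin normal_pdf_ge0.
Qed.

End convolution.

(** * Normal laws with variance zero allowed *)

Section gauss.
Context {R : realType}.
Implicit Types a c m s w x S : R.

(* The case s = 0 is separate because [normal_prob m 0] is the uniform law on [0, 1]. *)
Definition gauss m s : probability (measurableTypeR R) R :=
  if s == 0 then (dirac (m : measurableTypeR R) : probability _ _)
  else (normal_prob m s : probability _ _).

(** The degenerate cases matter because a linear form is built up from the empty sum, a point mass,
    and may have zero coefficients. *)
Lemma gauss_convolution m s m2 s2 w (B : set R) : s2 != 0 -> measurable B ->
  (\int[normal_prob m2 s2]_x gauss m s ((fun t => t + w * x)%R @^-1` B)
   = gauss (m + w * m2) (Num.sqrt (s ^+ 2 + w ^+ 2 * s2 ^+ 2)) B)%E.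
Proof.
move=> s20 mB.
have w2s2 : 0 <= w ^+ 2 * s2 ^+ 2 by rewrite mulr_ge0 ?sqr_ge0.
have S0 : (Num.sqrt (s ^+ 2 + w ^+ 2 * s2 ^+ 2) == 0) = (s == 0) && (w == 0).
  rewrite sqrtr_eq0 le_eqVlt ltNge addr_ge0 ?sqr_ge0//= orbF.
  by rewrite paddr_eq0 ?sqr_ge0// sqrf_eq0 mulf_eq0 !sqrf_eq0 (negbTE s20) orbF.
rewrite /gauss S0.
have [->|s0] := eqVneq s 0; last first.
  apply: normal_prob_convolution => //.
    by rewrite S0 (negbTE s0).
  by rewrite sqr_sqrtr// addr_ge0 ?sqr_ge0.
(* A point mass plus zero times a normal variable is still a point mass. For [w != 0] the sum is an
   affine image of the normal variable. *)
have [->|w0] /= := eqVneq w 0.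
  rewrite mul0r addr0.
  under eq_integral do rewrite mul0r.
  rewrite integral_cst// [X in (_ * X)%E]probability_setT mule1.
  by congr (\d_m _); apply/seteqP; split => t /=; rewrite addr0.
rewrite expr0n/= add0r -exprMn sqrtr_sqr normal_prob_abs addrC.
rewrite -normal_prob_affine//.
have mB' : measurable ((fun x => w * x + m) @^-1` B).
  by rewrite -[X in measurable X]setTI; exact: measurable_affine.
transitivity (\int[normal_prob m2 s2]_x (\1_((fun x => w * x + m)%R @^-1` B) x)%:E)%E.
  apply: eq_integral => x _; rewrite /= /dirac !indicE; congr (_%:R%:E).
  by congr nat_of_bool; apply/idP/idP; rewrite !inE /= addrC.
by rewrite integral_indic// setIT.
Qed.

End gauss.

(** * Law of a linear form in independent normal coordinates *)

Section indep.
Context {R : realType} {d} {Omega : measurableType d}.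
Implicit Types (w s : R).

(** Uniqueness of the product measure extends the product formula from rectangles to the set [D],
    whose sections yield the convolution integral. The factor [c] lets [P] be the restriction of a
    probability to an event. *)
Lemma gauss_add {P : {measure set Omega -> \bar R}} {c : {nonneg R}}
    {Z S : Omega -> R} {m s m2 s2} w :
  measurable_fun setT Z -> measurable_fun setT S -> s2 != 0 ->
  (forall A B : set R, measurable A -> measurable B ->
     P (Z @^-1` A `&` S @^-1` B) = c%:num%:E * (normal_prob m2 s2 A * gauss m s B))%E ->
  forall B : set R, measurable B ->
   (P ((fun om => S om + w * Z om)%R @^-1` B) =
    c%:num%:E * gauss (m + w * m2) (Num.sqrt (s ^+ 2 + w ^+ 2 * s2 ^+ 2)) B)%E.
Proof.
move=> mZ mS s20 indep B mB.
pose phi om : measurableTypeR R * measurableTypeR R := (Z om, S om).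
have mphi : measurable_fun setT phi by exact/measurable_fun_pairP.
pose Q : {measure set (measurableTypeR R * measurableTypeR R) -> \bar R} :=
  measure_function_pushforward__canonical__measure_function_Measure P mphi.
pose nu : {finite_measure set (measurableTypeR R) -> \bar R} := mscale c (gauss m s).
pose D := [set zt : measurableTypeR R * measurableTypeR R | B (zt.2 + w * zt.1)].
have mD : measurable D.
  have mf : measurable_fun setT
      (fun zt : measurableTypeR R * measurableTypeR R => zt.2 + w * zt.1 : R).
    apply: measurable_funD; first exact: measurable_snd.
    by apply: measurable_funM => //; exact: measurable_fst.
  by rewrite -[X in measurable X]setTI; exact: mf.
transitivity (Q D); first by [].
rewrite -(@product_measure_unique _ _ _ _ R (normal_prob m2 s2) nu Q)//; last first.
  move=> A C mA mC; transitivity (P (Z @^-1` A `&` S @^-1` C)); first by [].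
  by rewrite indep// muleCA.
have sectE x : xsection D x = (fun t => t + w * x) @^-1` B.
  by apply/seteqP; split => t; rewrite /xsection /= inE.
rewrite -gauss_convolution// -ge0_integralZl//.
  by apply: eq_integral => x _; rewrite /= /mscale sectE.
under eq_fun do rewrite -sectE.
exact: (@measurable_fun_xsection _ _ (measurableTypeR R) (measurableTypeR R) R (gauss m s) D mD).
Qed.

Lemma measurable_partial_dot {d'} (X : Omega -> d'.-tuple R) (w : d'.-tuple R) (p : pred 'I_d') :
  measurable_fun setT X ->
  measurable_fun setT (fun om => \sum_(j < d' | p j) tnth w j * tnth (X om) j).
Proof.
move=> mX; under eq_fun do rewrite -big_filter.
apply: measurable_sum => j; apply: measurable_funM => //.
exact: (measurableT_comp (measurable_tnth j) mX).
Qed.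

(** Induction on [k], moving one coordinate at a time into the sum. The sets [A j] for the
    coordinates not yet added stay in the statement so that independence survives in the induction
    hypothesis. *)
Lemma gauss_partial_dot {P : {measure set Omega -> \bar R}} {c : {nonneg R}} {n}
    {X : Omega -> n.-tuple R} {mu} (w : n.-tuple R) {s} :
  s != 0 -> measurable_fun setT X ->
  (forall A : 'I_n -> set R, (forall k, measurable (A k)) ->
    P [set om | forall k, A k (tnth (X om) k)] =
    c%:num%:E * \prod_(k < n) normal_prob (tnth mu k) s (A k))%E ->
  forall k, (k <= n)%N ->
  forall (A : 'I_n -> set R) (B : set R), (forall j, measurable (A j)) -> measurable B ->
  (P [set om | B (\sum_(j < n | (j < k)%N) tnth w j * tnth (X om) j)%R /\
              forall j : 'I_n, (k <= j)%N -> A j (tnth (X om) j)] =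
   c%:num%:E * (gauss (\sum_(j < n | (j < k)%N) tnth w j * tnth mu j)%R
                  (Num.sqrt (\sum_(j < n | (j < k)%N) (tnth w j ^+ 2 * s ^+ 2))) B *
     \prod_(j < n | (k <= j)%N) normal_prob (tnth mu j) s (A j)))%E.
Proof.
move=> s0 mX XE; elim=> [_ A B mA mB|k IH kn A B mA mB].
  have sum0 (V : nmodType) (F : 'I_n -> V) : (\sum_(j < n | (j < 0)%N) F j = 0)%R.
    by rewrite big_pred0.
  (* The empty sum follows the point mass at 0, so either [B] contains 0 and the hypothesis applies,
     or both sides vanish. *)
  rewrite !sum0 sqrtr0 /gauss eqxx /= /dirac indicE.
  have [/set_mem B0|/negP nB0] := boolP (0 \in B).
    rewrite mul1e (eq_bigl xpredT)// -XE//; congr (P _).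
    apply/seteqP; split => om /=; rewrite sum0; first by move=> [_ H] j; exact: H.
    by move=> H; split => // j _; exact: H.
  rewrite mul0e mule0; apply/eqP; rewrite -(measure0 P); apply/eqP; congr (P _).
  apply/seteqP; split => om //=; rewrite sum0 => -[B0 _].
  by apply: nB0; rewrite inE.
pose K := Ordinal kn.
have ltnSK j : (j < k.+1)%N && (j != K) = (j < k)%N.
  by rewrite ltnS (leq_eqVlt j k) -[j == K]/(j == k :> nat); case: ltngtP.
have sumS (V : nmodType) (F : 'I_n -> V) :
    (\sum_(j < n | (j < k.+1)%N) F j = F K + \sum_(j < n | (j < k)%N) F j)%R.
  by rewrite (bigD1 K)//=; congr (_ + _)%R; apply: eq_bigl => j; exact: ltnSK.
set p := (\prod_(j < n | (k.+1 <= j)%N) normal_prob (tnth mu j) s (A j))%E.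
have p0 : (0 <= p)%E by exact: prode_ge0.
have pfin : p \is a fin_num by apply: prode_fin_num => j _; apply: fin_num_measure; exact: mA.
have cp0 : 0 <= c%:num * fine p by rewrite mulr_ge0// fine_ge0.
(* Restricting [P] to the event [F] on the later coordinates leaves a two-variable problem for
   coordinate [K] and the partial sum; the mass [p] of these coordinates joins the constant. *)
pose F := \bigcap_(j in [set j : 'I_n | (k.+1 <= j)%N]) ((fun om => tnth (X om) j) @^-1` A j).
have mF : measurable F.
  apply: fin_bigcap_measurable => // j _; rewrite -[X in measurable X]setTI.
  exact: (measurableT_comp (measurable_tnth j) mX).
pose Q : {measure set Omega -> \bar R} := mrestr P mF.
have mZ : measurable_fun setT (fun om => tnth (X om) K).
  exact: (measurableT_comp (measurable_tnth K) mX).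
have mS := measurable_partial_dot X w (fun j : 'I_n => (j < k)%N) mX.
have indep (A0 B0 : set R) : measurable A0 -> measurable B0 ->
   (Q ((fun om => tnth (X om) K) @^-1` A0 `&`
       (fun om => \sum_(j < n | (j < k)%N) tnth w j * tnth (X om) j)%R @^-1` B0) =
    (NngNum cp0)%:num%:E * (normal_prob (tnth mu K) s A0 *
      gauss (\sum_(j < n | (j < k)%N) tnth w j * tnth mu j)%R
        (Num.sqrt (\sum_(j < n | (j < k)%N) (tnth w j ^+ 2 * s ^+ 2))) B0))%E.
  (* Replacing only the set at [K] by [A0] turns the rectangle into an instance of the induction
     hypothesis. *)
  move=> mA0 mB0; pose A' j := if j == K then A0 else A j.
  have mA' j : measurable (A' j) by rewrite /A'; case: ifP.
  have prodE : (\prod_(j < n | (k <= j)%N) normal_prob (tnth mu j) s (A' j) =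
      normal_prob (tnth mu K) s A0 * p)%E.
    rewrite (bigD1 K)//= {1}/A' eqxx; congr (_ * _)%E.
    apply: eq_big => j; first by rewrite -[j == K]/(j == k :> nat); case: ltngtP.
    by rewrite /A' => /andP[_ /negbTE ->].
  transitivity (P [set om | B0 (\sum_(j < n | (j < k)%N) tnth w j * tnth (X om) j)%R /\
              forall j : 'I_n, (k <= j)%N -> A' j (tnth (X om) j)]).
    rewrite /Q /= /mrestr; congr (P _); apply/seteqP; split => om /=.
      move=> [[A0X B0X] AX]; split => // j kj; rewrite /A'.
      have [->//|jK] := eqVneq j K; apply: AX => /=.
      by rewrite ltn_neqAle kj andbT; apply: contra jK => /eqP kj'; apply/eqP/val_inj.
    move=> [B0X AX]; split; [split => //|].
      by have := AX K (leqnn k); rewrite /A' eqxx.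
    move=> j /= kj; have := AX j (ltnW kj); rewrite /A'.
    by case: eqP => // jK; rewrite jK ltnn in kj.
  rewrite IH//; last exact: ltnW.
  by rewrite prodE /= EFinM fineK// -!muleA; congr (_ * _)%E; rewrite muleCA [RHS]muleC -muleA.
transitivity (Q ((fun om => \sum_(j < n | (j < k)%N) tnth w j * tnth (X om) j +
    tnth w K * tnth (X om) K)%R @^-1` B)).
  rewrite /Q /= /mrestr; congr (P _); apply/seteqP.
  by split => om /=; rewrite sumS addrC => -[].
rewrite (gauss_add (tnth w K) mZ mS s0 indep B mB) /= EFinM !sumS.
rewrite sqr_sqrtr; last by apply: sumr_ge0 => j _; rewrite mulr_ge0 ?sqr_ge0.
rewrite -muleA (fineK pfin) [X in (_ * X = _)%E]muleC.
by rewrite (addrC (tnth w K * tnth mu K)) (addrC (tnth w K ^+ 2 * s ^+ 2)).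
Qed.

(** The case [k = n] of the induction: no coordinate remains, and the accumulated variance is the
    square of [norm2 w * |s|]. *)
Lemma gauss_dot {P : {measure set Omega -> \bar R}} {c : {nonneg R}} {n}
    {X : Omega -> n.-tuple R} {mu} (w : n.-tuple R) {s} :
  s != 0 -> measurable_fun setT X ->
  (forall A : 'I_n -> set R, (forall k, measurable (A k)) ->
    P [set om | forall k, A k (tnth (X om) k)] =
    c%:num%:E * \prod_(k < n) normal_prob (tnth mu k) s (A k))%E ->
  forall B : set R, measurable B ->
  (P [set om | B (dot w (X om))] =
   c%:num%:E * gauss (dot w mu) (norm2 w * `|s|)%R B)%E.
Proof.
move=> s0 mX XE B mB.
have sumT (V : nmodType) (F : 'I_n -> V) :
    (\sum_(j < n | (j < n)%N) F j = \sum_(j < n) F j)%R.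
  by apply: eq_bigl => j; exact: ltn_ord.
have := gauss_partial_dot w s0 mX XE _ (leqnn n) (fun=> setT) B (fun=> measurableT) mB.
rewrite !sumT [X in (_ * (_ * X))%E]big_pred0; last by move=> j; rewrite leqNgt ltn_ord.
rewrite mule1 -mulr_suml sqrtrM; last by apply: sumr_ge0 => j _; exact: sqr_ge0.
rewrite sqrtr_sqr /norm2 {2 3}/dot.
under [X in Num.sqrt X]eq_bigr do rewrite expr2.
move=> <-; congr (P _); apply/seteqP; split => om /=; rewrite sumT; last by case.
by move=> BX; split.
Qed.
End indep.

(** * Algebra of the dot product and symmetry of the norms *)

Section vectors.
Context {R : realType} {d : nat}.
Implicit Types (x y w : d.-tuple R) (a : R).

Lemma dotC x y : dot x y = dot y x.
Proof. by apply: eq_bigr => i _; rewrite mulrC. Qed.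

Lemma dot_vsub w x y : dot w (vsub x y) = dot w x - dot w y.
Proof. by rewrite -sumrB; apply: eq_bigr => i _; rewrite tnth_mktuple mulrBr. Qed.

Lemma dot_vadd w x y : dot w (vadd x y) = dot w x + dot w y.
Proof. by rewrite -big_split; apply: eq_bigr => i _; rewrite tnth_mktuple mulrDr. Qed.

Lemma dot_vscale a w x : dot w (vscale a x) = a * dot w x.
Proof. by rewrite mulr_sumr; apply: eq_bigr => i _; rewrite tnth_mktuple mulrCA. Qed.

Lemma vsubKC x y : vsub x (vsub x y) = y.
Proof. by apply: eq_from_tnth => i; rewrite !tnth_mktuple opprB addrC subrK. Qed.

Lemma pnormN p x : pnorm p (vscale (-1) x) = pnorm p x.
Proof.
have xN i : `|tnth (vscale (-1) x) i| = `|tnth x i|.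
  by rewrite tnth_mktuple mulN1r normrN.
case: p => [r| |]; last by []; rewrite /pnorm.
  by congr (_ `^ _); apply: eq_bigr => i _; rewrite xN.
by apply: eq_bigr => i _; rewrite xN.
Qed.

Lemma norm2_gt0 w : (exists k, tnth w k != 0) -> 0 < norm2 w.
Proof.
move=> [k wk]; rewrite sqrtr_gt0 /dot (bigD1 k)//= ltr_pwDl//.
  by rewrite -expr2 lt_def sqrf_eq0 wk sqr_ge0.
by apply: sumr_ge0 => i _; rewrite -expr2 sqr_ge0.
Qed.

End vectors.

(** * Normal probabilities of half-lines *)

Section Phi.
Context {R : realType}.
Implicit Types m s t : R.

Lemma PhiE t : (Phi t)%:E = normal_prob 0 1 `]-oo, t]%classic.
Proof. by rewrite /Phi fineK// fin_num_measure. Qed.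

Lemma normal_prob_itvNyc m s t : 0 < s ->
  normal_prob m s `]-oo, t]%classic = (Phi ((t - m) / s))%:E.
Proof.
move=> s0; have sn0 := gt_eqF s0.
rewrite PhiE (_ : `]-oo, t]%classic =
    (fun x => s^-1 * x - s^-1 * m) @^-1` `]-oo, (t - m) / s]%classic).
  rewrite normal_prob_affine ?invr_eq0 ?sn0//.
  by rewrite subrr mulVf// sn0.
apply/seteqP; split => x /=; rewrite !in_itv/= -mulrBr mulrC ler_pM2r ?invr_gt0//; lra.
Qed.

(** Reflection at 0 maps the upper half-line to a lower one. That one is open, and its endpoint
    carries no mass. *)
Lemma normal_prob_itvoy m s t : 0 < s ->
  normal_prob m s `]t, +oo[%classic = (Phi ((m - t) / s))%:E.
Proof.
move=> s0; have sn0 := gt_eqF s0.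
rewrite (_ : `]t, +oo[%classic = (fun x => -1 * x + 0) @^-1` `]-oo, - t[%classic); last first.
  by apply/seteqP; split => x /=; rewrite !in_itv/= ?andbT mulN1r addr0 ltrN2.
rewrite normal_prob_affine ?oppr_eq0 ?oner_eq0 ?sn0//.
rewrite -normal_prob_abs !mulN1r addr0 normrN (gtr0_norm s0).
have -> : (m - t) / s = (- t - - m) / s by rewrite opprK addrC.
rewrite -normal_prob_itvNyc//; apply: integral_itv_bndo_bndc.
by apply/measurable_EFinP; apply: measurable_funTS; exact: measurable_normal_pdf.
Qed.

End Phi.

(** Conditioning on [E] is expressed by restricting [P] to [E], with [c] in the role of the mass of
    [E]. Positivity of [norm2 w] and [sigma] excludes the point mass. *)
Lemma normal_prob_dot (R : realType) dd (Omega : measurableType dd)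
  (P : {measure set Omega -> \bar R}) d (E : set Omega) (X : Omega -> d.-tuple R)
  (mu w : d.-tuple R) (c : {nonneg R}) (sigma : R) :
  measurable E -> measurable_fun [set: Omega] X -> 0 < sigma -> 0 < norm2 w ->
  (forall A : 'I_d -> set R, (forall k, measurable (A k)) ->
     P (E `&` [set om | forall k, A k (tnth (X om) k)]) =
     (c%:num%:E * \prod_(k < d) normal_prob (tnth mu k) sigma (A k))%E) ->
  forall B : set R, measurable B ->
  P (E `&` [set om | B (dot w (X om))]) =
  (c%:num%:E * normal_prob (dot w mu) (norm2 w * sigma) B)%E.
Proof.
move=> mE mX s0 w0 XE B mB.
have law : forall A : 'I_d -> set R, (forall k, measurable (A k)) ->
    (mrestr P mE [set om | forall k, A k (tnth (X om) k)] =
    c%:num%:E * \prod_(k < d) normal_prob (tnth mu k) sigma (A k))%E.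
  by move=> A mA; rewrite /mrestr setIC XE.
have -> : P (E `&` [set om | B (dot w (X om))]) = mrestr P mE [set om | B (dot w (X om))].
  by rewrite /mrestr setIC.
have := gauss_dot w (lt0r_neq0 s0) mX law B mB.
by rewrite (gtr0_norm s0) /gauss mulf_eq0 (gt_eqF s0) (gt_eqF w0).
Qed.

(** * Which points admit an adversarial perturbation *)

Section adversarial.
Context {R : realType} {d : nat}.
Variables (p : \bar R) (w m0 u : d.-tuple R) (b eps delta : R).
Let feasible (v : d.-tuple R) := pnorm p v <= eps /\ `|dot v m0| <= delta.
Let classify (x : d.-tuple R) := 0 < dot w x + b.
Hypotheses (feas_u : feasible u) (u_max : forall v, feasible v -> `|dot w v| <= `|dot w u|)
  (wu0 : 0 <= dot w u).

(** An admissible perturbation moves the score by at most [dot w u], and [u] and its negative attain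
    both extremes. The left inequality is strict because score 0 belongs to the negative class. *)
Lemma adversarial_exampleP x :
  (exists x', pnorm p (vsub x x') <= eps /\ `|dot (vsub x x') m0| <= delta /\
     classify x' != classify x) <->
  - dot w u < dot w x + b <= dot w u.
Proof.
have feasE x' : pnorm p (vsub x x') <= eps /\ `|dot (vsub x x') m0| <= delta ->
    - dot w u <= dot w x - dot w x' <= dot w u.
  by move=> /u_max; rewrite (ger0_norm wu0) ler_norml dot_vsub.
split=> [[x' [xx' [xx'm]]]|/andP[lo hi]].
  have /andP[lo hi] := feasE x' (conj xx' xx'm).
  rewrite /classify; case: ltP => h1; case: ltP => h2 // _; apply/andP; split; lra.
case: feas_u => u1 u2.
have [x0|x0] := ltP 0 (dot w x + b).
  exists (vsub x u); rewrite vsubKC /classify dot_vsub x0; do 2!split => //.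
  by rewrite eqb_id -leNgt; lra.
(* A nonpositive score is raised as far as possible by adding [u], that is, by subtracting its
   negative. *)
exists (vsub x (vscale (-1) u)).
rewrite vsubKC pnormN dotC dot_vscale dotC mulN1r normrN.
rewrite /classify dot_vsub dot_vscale (le_gtF x0) eqbF_neg negbK; do 2!split => //.
lra.
Qed.
End adversarial.

(** * Partition of the sample space and evaluation of its pieces *)

Theorem theorem5 (R : realType) (dd : measure_display) (Omega : measurableType dd)
  (P : probability Omega R) (d : nat) (p : \bar R)
  (mup mum : d.-tuple R) (sigma : R)
  (X : Omega -> d.-tuple R) (Y : Omega -> bool)
  (w : d.-tuple R) (b eps delta : R) (u : d.-tuple R) :
  (1 <= p)%E ->
  mup != mum ->
  0 < sigma ->
  measurable_fun [set: Omega] X ->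
  measurable_fun [set: Omega] Y ->
  (* Y = true is class +, Y = false is class -; P(Y = i) = 1/2 and
     X | Y = i ~ N(mu_i, sigma^2 I_d), i.e. the coordinates of X are,
     conditionally on Y = i, independent N((mu_i)_k, sigma^2) *)
  (forall (i : bool) (A : 'I_d -> set R), (forall k, measurable (A k)) ->
     P [set om | Y om = i /\ forall k, A k (tnth (X om) k)] =
     ((1/2)%:E * \prod_(k < d) normal_prob (tnth (if i then mup else mum) k) sigma (A k))%E) ->
  (exists k, tnth w k != 0) ->
  0 < eps -> 0 <= delta ->
  let mu := vscale (1/2) (vsub mup mum) in
  let mubar := vscale (1/2) (vadd mup mum) in
  let b' := dot w mubar + b in
  let mu0 := vscale (norm2 mu)^-1 mu in
  let feasible := fun v : d.-tuple R => pnorm p v <= eps /\ `|dot v mu0| <= delta in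
  let classify := fun x : d.-tuple R => (0 < dot w x + b) in
  feasible u ->
  (forall v, feasible v -> `|dot w v| <= `|dot w u|) ->
  0 <= dot w u ->
  P [set om | classify (X om) = Y om /\
       exists x', pnorm p (vsub (X om) x') <= eps /\
                  `|dot (vsub (X om) x') mu0| <= delta /\
                  classify x' != classify (X om)] =
  (1 - P [set om | classify (X om) != Y om] -
   (1/2)%:E * (Phi ((dot w mu + b') / (norm2 w * sigma) - dot w u / (norm2 w * sigma)) +
               Phi ((dot w mu - b') / (norm2 w * sigma) - dot w u / (norm2 w * sigma)))%:E)%E.
Proof.
move=> _ _ s0 mX mY XE /norm2_gt0 w0 _ _ mu mubar b' mu0 feasible classify fu umax wu0.
set adv := [set om | classify (X om) = Y om /\ _].
set mis := [set om | classify (X om) != Y om].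
have ws0 : 0 < norm2 w * sigma by exact: mulr_gt0.
have mYi i : measurable (Y @^-1` [set i]) by rewrite -[X in measurable X]setTI; exact: mY.
have mwX : measurable_fun setT (fun om => dot w (X om)).
  exact: (measurable_partial_dot X w xpredT mX).
have half0 : 0 <= 1/2 :> R by rewrite divr_ge0.
have law i (B : set R) : measurable B ->
    (P (Y @^-1` [set i] `&` [set om | B (dot w (X om))]) =
     (1/2)%:E * normal_prob (dot w (if i then mup else mum)) (norm2 w * sigma) B)%E.
  by apply: (@normal_prob_dot _ _ _ _ _ _ _ _ _ (NngNum half0)) => // A mA; exact: XE.
pose c := dot w u.
(* [hitp] and [hitm] collect the correctly classified points of each class that no admissible
   perturbation can flip: scores above [c], respectively at most [- c]. *)
pose hitp := Y @^-1` [set true] `&` [set om | `]c - b, +oo[%classic (dot w (X om))].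
pose hitm := Y @^-1` [set false] `&` [set om | `]-oo, - c - b]%classic (dot w (X om))].
have mpre i (B : set R) : measurable B ->
    measurable (Y @^-1` [set i] `&` [set om | B (dot w (X om))]).
  by move=> mB; apply: measurableI => //; rewrite -[X in measurable X]setTI; exact: mwX.
have mhitp : measurable hitp by apply: mpre.
have mhitm : measurable hitm by apply: mpre.
have misE : mis = (Y @^-1` [set true] `&` [set om | `]-oo, - b]%classic (dot w (X om))]) `|`
                  (Y @^-1` [set false] `&` [set om | `]- b, +oo[%classic (dot w (X om))]).
  apply/seteqP; split => om; rewrite /mis /classify /= !in_itv/= ?andbT.
    by case: (Y om); case: ltP => // h _; [left|right]; split => //; lra.
  by case: (Y om) => -[] [] // _ h; case: ltP => //; lra.
have mmis : measurable mis by rewrite misE; apply: measurableU; apply: mpre.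
have advE : adv = ~` (mis `|` (hitp `|` hitm)).
  apply/seteqP; split => om; rewrite /adv /mis /hitp /hitm /= !in_itv/= ?andbT.
    move=> [XY /(adversarial_exampleP _ _ _ _ _ _ _ fu umax wu0)] /andP[lo hi].
    rewrite XY eqxx -XY => -[//|[[]|[]]] _; rewrite -/c in lo hi *; lra.
  move=> /not_orP[/negP + /not_orP[hp hm]]; rewrite negbK => /eqP XY; split => //.
  apply/(adversarial_exampleP _ _ _ _ _ _ _ fu umax wu0); rewrite -/c.
  have c0 : 0 <= c by [].
  have [x0|x0] := ltP 0 (dot w (X om) + b); move: XY; rewrite /classify.
    rewrite x0 => /esym Y1; apply/andP; split; first lra.
    by rewrite leNgt; apply/negP => h; apply: hp; split => //; lra.
  rewrite ltNge x0 => /esym Y0; apply/andP; split; last lra.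
  by rewrite ltNge; apply/negP => h; apply: hm; split => //; lra.
have Phip : P hitp =
    ((1/2)%:E * (Phi ((dot w mu + b') / (norm2 w * sigma) - c / (norm2 w * sigma)))%:E)%E.
  rewrite /hitp (law true _ (measurable_itv _)) (normal_prob_itvoy _ _ _ ws0) -mulrBl.
  (* Here [mup] is [mubar] plus [mu], so the mean score of class + is [dot w mu + b']. *)
  have -> // : dot w mup - (c - b) = dot w mu + b' - c.
  by rewrite /b' !dot_vscale dot_vsub dot_vadd; field.
have Phim : P hitm =
    ((1/2)%:E * (Phi ((dot w mu - b') / (norm2 w * sigma) - c / (norm2 w * sigma)))%:E)%E.
  rewrite /hitm (law false _ (measurable_itv _)) (normal_prob_itvNyc _ _ _ ws0) -mulrBl.
  (* Here [mum] is [mubar] minus [mu], so the mean score of class - is [b' - dot w mu]. *)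
  have -> // : - c - b - dot w mum = dot w mu - b' - c.
  by rewrite /b' !dot_vscale dot_vsub dot_vadd; field.
rewrite advE probability_setC; last by apply: measurableU => //; exact: measurableU.
have disj2 : hitp `&` hitm = set0.
  by apply/seteqP; split => om // [[/= + _] [/= + _]] => ->.
(* As [c] is nonnegative, a score beyond the threshold on the side of the true class is classified
   correctly. *)
have disj1 : mis `&` (hitp `|` hitm) = set0.
  apply/seteqP; split => om //; rewrite /mis /hitp /hitm /classify /= !in_itv/= ?andbT.
  have c0 : 0 <= c by [].
  by case: (Y om) => -[neq [[] // _ h|[] // _ h]]; move: neq; case: ltP => // h' _; lra.
have Phit : (P (hitp `|` hitm) = P hitp + P hitm)%E by rewrite measureU.
have -> : (P (mis `|` (hitp `|` hitm)) = P mis + P (hitp `|` hitm))%E.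
  by rewrite measureU//; exact: measurableU.
rewrite Phit Phip Phim -muleDr//.
(* Negation distributes over an extended-real sum here because the probability of misclassification
   is finite. *)
by rewrite fin_num_oppeD ?addeA// fin_num_measure.
Qed.
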